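(* Let $\lambda=(\lambda_1,\ldots,\lambda_l)$ be a partition of $n$ with $\lambda\neq(n)$. If $R/I_\lambda^{\mathrm{Sp}}$ is Cohen--Macaulay, then one of the following conditions is satisfied: (1) $\lambda_2=1$; (2) $l=2$; (3) $l=3$, $\lambda_1=\lambda_2$ and $\lambda_3=1$.
   Context: Let $K$ be a field, $n\ge 2$, $[n]=\{1,\ldots,n\}$, and $R=K[x_1,\ldots,x_n]$. A partition of $n$ is a sequence $\lambda=(\lambda_1,\ldots,\lambda_l)$ of integers with $\lambda_1\ge\cdots\ge\lambda_l\ge1$ and $\sum_i\lambda_i=n$; the trivial partition $(n)$ is excluded throughout. A tableau of shape $\lambda$ is a bijection from $[n]$ to the set of boxes of the (left-justified) Young diagram of $\lambda$, which has $\lambda_i$ boxes in row $i$. For a tableau $T$ of shape $\lambda$, if the $j$-th column of $T$ consists of $j_1,\ldots,j_m$ from top to bottom, set $f_T(j)=\prod_{1\le s<t\le m}(x_{j_s}-x_{j_t})$ (equal to $1$ if $m=1$), and let the Specht polynomial of $T$ be $f_T=\prod_{j=1}^{\lambda_1}f_T(j)$. The Specht ideal is $I_\lambda^{\mathrm{Sp}}=(f_T\mid T\text{ a tableau of shape }\lambda)\subset R$. *)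

(* Defs.v *)
From HB Require Import structures.
From mathcomp Require Import all_boot all_order all_algebra.
From mathcomp Require Import generic_quotient ring_quotient.
From mathcomp Require Import boolp.
From mathcomp Require Import ring.
From mathcomp Require Import mpoly.

Set Implicit Arguments.
Unset Strict Implicit.
Unset Printing Implicit Defensive.

Import GRing.Theory.
Local Open Scope ring_scope.
Local Open Scope quotient_scope.

(* Following ring_quotient, an [idealr A] is a proper ideal of [A]; predicates
   given by a proposition are turned into boolean ones with [`[< _ >]]. *)

Section GeneratedIdeal.
Variable A : comNzRingType.

Definition ideal_gen (S : A -> Prop) : {pred A} :=
  fun x => `[< exists2 s : seq (A * A),
                 (forall u, u \in s -> S u.2) & x = \sum_(u <- s) u.1 * u.2 >].

Definition ideal_gen_seq (s : seq A) : {pred A} := ideal_gen (fun x => x \in s).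

Lemma ideal_gen0 S : 0 \in ideal_gen S.
Proof. by apply/asboolP; exists [::]; rewrite ?big_nil. Qed.

Lemma ideal_gen_lin S a : {in ideal_gen S &, forall u v, a * u + v \in ideal_gen S}.
Proof.
move=> u v /asboolP[s Ss ->] /asboolP[t St ->]; apply/asboolP.
exists ([seq (a * w.1, w.2) | w <- s] ++ t).
  move=> w; rewrite mem_cat => /orP[/mapP[z zs ->]|]; last exact: St.
  exact: Ss zs.
rewrite big_cat big_map mulr_sumr /=; congr (_ + _).
by apply: eq_bigr => i _; rewrite mulrA.
Qed.

Lemma ideal_gen_idealr S : 1 \notin ideal_gen S -> idealr_closed (ideal_gen S).
Proof. by move=> S1; split; [exact: ideal_gen0| |exact: ideal_gen_lin]. Qed.

Definition gen_idealr S (S1 : 1 \notin ideal_gen S) : idealr A :=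
  HB.pack_for (idealr A) (ideal_gen S : A -> bool)
    (isIdealr.Build A (ideal_gen S) (ideal_gen_idealr S1)).

End GeneratedIdeal.

(* The localization of A at the complement of the prime ideal p. *)
Module Localization.
Section Localization.
Variables (A : comNzRingType) (p : prime_idealr A).

Lemma den1 : 1 \notin p. Proof. by rewrite idealr1. Qed.

Lemma denM s t : s \notin p -> t \notin p -> s * t \notin p.
Proof. by rewrite prime_idealrM negb_or => -> ->. Qed.

Definition den := {s : A | s \notin p}.
Definition den_one : den := exist _ 1 den1.
Definition den_mul (s t : den) : den := exist _ (sval s * sval t) (denM (svalP s) (svalP t)).

Local Notation frac := (A * den)%type.

Implicit Types x y z : frac.

Definition equiv x y : bool :=
  `[< exists2 u : A, u \notin p & u * (x.1 * sval y.2) = u * (y.1 * sval x.2) >].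

Lemma equiv_refl : reflexive equiv.
Proof. by move=> x; apply/asboolP; exists 1; rewrite ?den1. Qed.

Lemma equiv_sym : ssrbool.symmetric equiv.
Proof. by move=> x y; apply/asboolP/asboolP => -[u pu e]; exists u. Qed.

Lemma equiv_trans : transitive equiv.
Proof.
move=> y x z /asboolP[u pu e] /asboolP[v pv f]; apply/asboolP.
exists (u * v * sval y.2); first by rewrite !denM ?(svalP y.2).
transitivity ((u * (x.1 * sval y.2)) * v * sval z.2); first by ring.
rewrite e; transitivity ((v * (y.1 * sval z.2)) * u * sval x.2); first by ring.
by rewrite f; ring.
Qed.

Canonical equiv_equiv := EquivRel equiv equiv_refl equiv_sym equiv_trans.

Definition type := {eq_quot equiv}.
#[export]
HB.instance Definition _ : EqQuotient _ equiv type := EqQuotient.on type.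
#[export]
HB.instance Definition _ := Choice.on type.

Lemma equiv_def x y : (x == y %[mod type]) = equiv x y.
Proof. by rewrite eqmodE. Qed.

Lemma equiv_repr x : equiv (repr (\pi_type x)) x.
Proof. by rewrite -equiv_def reprK. Qed.

Definition addf x y : frac :=
  (x.1 * sval y.2 + y.1 * sval x.2, den_mul x.2 y.2).
Definition oppf x : frac := (- x.1, x.2).
Definition mulf x y : frac := (x.1 * y.1, den_mul x.2 y.2).

Definition zero : type := lift_cst type (0, den_one).
Definition one : type := lift_cst type (1, den_one).
Definition add := lift_op2 type addf.
Definition opp := lift_op1 type oppf.
Definition mul := lift_op2 type mulf.

Canonical pi_zero_morph := PiConst zero.
Canonical pi_one_morph := PiConst one.

Lemma pi_add : {morph \pi : x y / addf x y >-> add x y}.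
Proof.
move=> x y; unlock add; apply/eqP; rewrite equiv_def equiv_sym.
have /asboolP[u pu e] := equiv_repr x; have /asboolP[v pv f] := equiv_repr y.
set x' := repr _ in e *; set y' := repr _ in f *.
apply/asboolP; exists (u * v); first exact: denM.
rewrite /addf /=.
transitivity ((u * (x'.1 * sval x.2)) * v * sval y'.2 * sval y.2 +
              (v * (y'.1 * sval y.2)) * u * sval x'.2 * sval x.2); first by ring.
by rewrite e f; ring.
Qed.
Canonical pi_add_morph := PiMorph2 pi_add.

Lemma pi_opp : {morph \pi : x / oppf x >-> opp x}.
Proof.
move=> x; unlock opp; apply/eqP; rewrite equiv_def equiv_sym.
have /asboolP[u pu e] := equiv_repr x.
by apply/asboolP; exists u => //=; rewrite !mulNr !mulrN e.
Qed.
Canonical pi_opp_morph := PiMorph1 pi_opp.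

Lemma pi_mul : {morph \pi : x y / mulf x y >-> mul x y}.
Proof.
move=> x y; unlock mul; apply/eqP; rewrite equiv_def equiv_sym.
have /asboolP[u pu e] := equiv_repr x; have /asboolP[v pv f] := equiv_repr y.
set x' := repr _ in e *; set y' := repr _ in f *.
apply/asboolP; exists (u * v); first exact: denM.
rewrite /mulf /=.
transitivity ((u * (x'.1 * sval x.2)) * (v * (y'.1 * sval y.2))); first by ring.
by rewrite e f; ring.
Qed.
Canonical pi_mul_morph := PiMorph2 pi_mul.

Lemma equivW x y : x.1 * sval y.2 = y.1 * sval x.2 -> \pi_type x = \pi_type y.
Proof.
move=> e; apply/eqP; rewrite equiv_def; apply/asboolP.
by exists 1; rewrite ?den1 // e.
Qed.

Lemma addA : associative add.
Proof.
elim/quotW=> x; elim/quotW=> y; elim/quotW=> z; rewrite !piE.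
by apply: equivW => /=; ring.
Qed.

Lemma addC : commutative add.
Proof.
by elim/quotW=> x; elim/quotW=> y; rewrite !piE; apply: equivW => /=; ring.
Qed.

Lemma add0l : left_id zero add.
Proof. by elim/quotW=> x; rewrite !piE; apply: equivW => /=; ring. Qed.

Lemma addNl : left_inverse zero opp add.
Proof. by elim/quotW=> x; rewrite !piE; apply: equivW => /=; ring. Qed.

Lemma mulA : associative mul.
Proof.
elim/quotW=> x; elim/quotW=> y; elim/quotW=> z; rewrite !piE.
by apply: equivW => /=; ring.
Qed.

Lemma mulC : commutative mul.
Proof.
by elim/quotW=> x; elim/quotW=> y; rewrite !piE; apply: equivW => /=; ring.
Qed.

Lemma mul1l : left_id one mul.
Proof. by elim/quotW=> x; rewrite !piE; apply: equivW => /=; ring. Qed.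

Lemma mul_addl : left_distributive mul add.
Proof.
elim/quotW=> x; elim/quotW=> y; elim/quotW=> z; rewrite !piE.
by apply: equivW => /=; ring.
Qed.

Lemma nonzero1 : one != zero.
Proof.
rewrite !piE; apply/asboolP => -[u pu] /=.
by rewrite !mulr1 mulr0 => u0; rewrite u0 idealr0 in pu.
Qed.

#[export]
HB.instance Definition _ := GRing.isZmodule.Build type addA addC add0l addNl.
#[export]
HB.instance Definition _ :=
  GRing.Zmodule_isComNzRing.Build type mulA mulC mul1l mul_addl nonzero1.

End Localization.
Module Exports. HB.reexport. End Exports.
End Localization.

Export Localization.Exports.

Notation localization p := (Localization.type p).

Section CohenMacaulay.
Variable A : comNzRingType.

Definition noetherian : Prop :=
  forall I : idealr A, exists s : seq A, I =i ideal_gen_seq s.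

Definition unique_maximal (m : idealr A) : Prop :=
  let maximal (I : idealr A) :=
    forall J : idealr A, {subset I <= J} -> J =i I in
  maximal m /\ forall m' : idealr A, maximal m' -> m' =i m.

Definition regular_seq (s : seq A) : Prop :=
  1 \notin ideal_gen_seq s /\
  forall (i : nat) (a : A), (i < size s)%N ->
    s`_i * a \in ideal_gen_seq (take i s) -> a \in ideal_gen_seq (take i s).

Definition has_depth (m : idealr A) (d : nat) : Prop :=
  (exists s : seq A, [/\ {subset s <= m}, regular_seq s & size s = d]) /\
  (forall s : seq A, {subset s <= m} -> regular_seq s -> (size s <= d)%N).

(* P 0 < P 1 < ... < P d is strictly increasing; P is irrelevant beyond d. *)
Definition prime_chain (d : nat) : Prop :=
  exists P : nat -> prime_idealr A, forall i : nat, (i < d)%N ->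
    {subset P i <= P i.+1} /\ ~ {subset P i.+1 <= P i}.

Definition has_krull_dim (d : nat) : Prop :=
  prime_chain d /\ forall e : nat, prime_chain e -> (e <= d)%N.

(* Depth and Krull dimension of a Noetherian local ring are finite, so their
   equality is stated as having a common value in nat. *)
Definition cohen_macaulay_local : Prop :=
  noetherian /\
  exists2 m : idealr A, unique_maximal m &
    exists2 d : nat, has_depth m d & has_krull_dim d.

End CohenMacaulay.

(* A is Noetherian and all its local rings are Cohen-Macaulay. *)
Definition cohen_macaulay (A : comNzRingType) : Prop :=
  noetherian A /\ forall p : prime_idealr A, cohen_macaulay_local (localization p).

Definition is_partition (n : nat) (la : seq nat) : bool :=
  [&& sorted geq la, all (leq 1) la & sumn la == n].

(* The boxes of the Young diagram, as pairs (row, column) counted from 0. *)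
Definition box (la : seq nat) : Type := {i : 'I_(size la) & 'I_(nth 0%N la i)}.

Record tableau (n : nat) (la : seq nat) : Type := Tableau {
  tab_fun :> 'I_n -> box la;
  tab_bij : bijective tab_fun
}.

Section Specht.
Variables (K : fieldType) (n : nat) (la : seq nat).
Implicit Type T : tableau n la.

Definition row_of T (a : 'I_n) : nat := tag (T a).
Definition col_of T (a : 'I_n) : nat := tagged (T a).

(* Going down a column means increasing the row index, so the pairs s < t of
   positions in column j are the pairs of entries (a, b) of that column with a
   strictly above b. *)
Definition specht_col T (j : nat) : {mpoly K[n]} :=
  \prod_(a < n) \prod_(b < n | [&& col_of T a == j, col_of T b == j
                                 & (row_of T a < row_of T b)%N]) ('X_a - 'X_b).

Definition specht_poly T : {mpoly K[n]} :=
  \prod_(j < nth 0%N la 0) specht_col T j.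

Definition is_specht_poly (f : {mpoly K[n]}) : Prop :=
  exists T : tableau n la, f = specht_poly T.

Lemma specht_poly_at0 T : is_partition n la -> (2 <= n)%N -> la <> [:: n] ->
  (specht_poly T).@[fun=> 0] = 0.
Proof.
case: T => T [T' TK T'K]; rewrite /specht_poly /specht_col /row_of /col_of /=.
case: la T T' TK T'K => [|l0 [|l1 l]] T T' TK T'K /and3P[_ pos /eqP sm] n2 ne.
- by rewrite -sm in n2.
- by case: ne; rewrite -sm /= addn0.
move: pos => /= /and3P[l0p l1p _].
pose b0 : box [:: l0, l1 & l] :=
  @Tagged _ (Ordinal (isT : 0 < (size l).+2)%N) _ (Ordinal l0p).
pose b1 : box [:: l0, l1 & l] :=
  @Tagged _ (Ordinal (isT : 1 < (size l).+2)%N) _ (Ordinal l1p).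
rewrite rmorph_prod; apply/eqP/prodf_eq0; exists (Ordinal l0p) => //=.
rewrite rmorph_prod; apply/prodf_eq0; exists (T' b0) => //=.
rewrite rmorph_prod; apply/prodf_eq0; exists (T' b1); first by rewrite !T'K /=.
by rewrite rmorphB /= !mevalXU subr0.
Qed.

Lemma specht_proper : is_partition n la -> (2 <= n)%N -> la <> [:: n] ->
  1 \notin ideal_gen is_specht_poly.
Proof.
move=> hla n2 ne; apply/asboolP => -[s Ss /(congr1 (meval (fun=> 0)))].
rewrite meval1 rmorph_sum big_seq big1 /=; first exact/eqP/oner_neq0.
by move=> u /Ss[T ->]; rewrite mevalM specht_poly_at0 ?mulr0.
Qed.

Definition specht_ideal (hn : (2 <= n)%N) (hla : is_partition n la)
    (hne : la <> [:: n]) : idealr {mpoly K[n]} :=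
  gen_idealr (specht_proper hla hn hne).

End Specht.

(* Main.v *)
Require Import Defs.
From HB Require Import structures.
From mathcomp Require Import all_boot all_algebra generic_quotient ring_quotient perm boolp ring zify mpoly.
Set Implicit Arguments.
Unset Strict Implicit.
Unset Printing Implicit Defensive.
Import GRing.Theory.
Local Open Scope ring_scope.
Local Open Scope quotient_scope.

(** Write a >= b for the first two parts of the partition and assume b >= 2 and
    that there is a third part.  Points of K^n are thought of through the blocks
    of coordinates on which they are constant; the Specht ideal vanishes on the
    subspace V_F where the coordinates in F agree as soon as F has a + 1 elements,
    because a tableau has only a columns.  The failure of Cohen-Macaulayness is
    detected by Hartshorne's connectedness argument: a local ring of depth at
    least 2 has a connected punctured spectrum.  Here this takes the following
    elementary form ([no_regular_pair]): if two nonzero ideals J1 and J2 of a local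
    ring have product zero and every element of the maximal ideal has a power in
    J1 + J2, then there is no regular sequence of length 2.  So it suffices to
    find a prime p at which such ideals exist and below which there is a chain
    q0 < q1 < p of primes containing the Specht ideal: the localization at p then
    has dimension at least 2 and depth at most 1 ([quotient_not_cm]).

    All primes involved are kernels of substitutions X_i |-> X_(r i), that is,
    ideals of linear subspaces.  A Specht polynomial is a product of differences
    X_x - X_y, most of which are units at p, so that explicit elements of the
    localized Specht ideal are obtained from well-chosen tableaux
    ([saturation_diff_prod]).

    If a = b and there are at least two boxes below the second row
    ([not_cm_equal_rows]), let F and G be disjoint blocks with a + 1 elements.  At
    the generic point of the intersection of V_F and V_G, the zero set is the union
    of these two subspaces, in each of which the intersection has codimension
    a >= 2, and the product of their ideals lies in the localized Specht ideal.
    These two ideals are J1 and J2; their sum is p.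

    If a > b ([not_cm_unequal_rows]), let B be a block of a + b + 1 elements, split
    into S of size a and S' of size b + 1.  The subspace on which the coordinates
    in S agree and those in S' agree is a component of dimension one around the
    point where all the coordinates in B agree, whereas V_F has dimension b >= 2
    there, for a subset F of B with a + 1 elements.  The product z of the
    differences of a coordinate in S and one in S' is killed by the ideal q of
    that component, and q + (z) contains a power of each element of p.  Hence J1 = (z)
    and J2 = q do the job.

    The partitions left out by these two cases are those of the conclusion. *)

(** * Regular sequences of length two *)

Section RegularPair.
Variable A : comNzRingType.
Implicit Types (f g : A) (a b : A -> Prop).

Definition regular_pair f g : Prop :=
  (forall x, f * x = 0 -> x = 0) /\
  (forall x y, g * x = f * y -> exists z, x = f * z).

(** Needed because only powers of elements of the maximal ideal decompose. *)
Lemma regular_pair_exp f g (i j : nat) :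
  regular_pair f g -> regular_pair (f ^+ i) (g ^+ j).
Proof.
move=> [f_reg g_reg].
have fi_reg k x : f ^+ k * x = 0 -> x = 0.
  by elim: k => [|k IHk]; rewrite ?mul1r // exprS -mulrA => /f_reg/IHk.
split=> [x|]; first exact: fi_reg.
have g_fi k : forall x y, g * x = f ^+ k * y -> exists z, x = f ^+ k * z.
  elim: k => [|k IHk] x y; first by exists x; rewrite mul1r.
  rewrite exprS -mulrA => gx; have [x1 def_x] := g_reg _ _ gx.
  have [|z def_x1] := IHk x1 y; last by exists z; rewrite def_x def_x1 mulrA.
  apply/eqP; rewrite -subr_eq0; apply/eqP/f_reg.
  by rewrite mulrBr -gx def_x; ring.
elim: j => [|j IHj] x y; first by rewrite mul1r => ->; exists y.
by rewrite exprS -mulrA => /g_fi[z /IHj].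
Qed.

(** Write f = u + v and g = s + t with u, s in a and v, t in b.  The products of
    elements of a and b vanish, so g u = f s, and regularity of g modulo f gives
    u = f c.  Then u (1 - c) = v c is killed by f, hence is zero.  As c or 1 - c is
    a unit, f lies in a or in b, which then annihilates the other one. *)
Lemma no_regular_pair a b f g :
  (forall c : A, (exists d, d * c = 1) \/ (exists d, d * (1 - c) = 1)) ->
  (forall x y, a x -> b y -> x * y = 0) ->
  (exists2 x, a x & x <> 0) -> (exists2 y, b y & y <> 0) ->
  (exists u v, [/\ a u, b v & f = u + v]) ->
  (exists s t, [/\ a s, b t & g = s + t]) ->
  ~ regular_pair f g.
Proof.
move=> local ab0 [x ax x0] [y byy y0] [u [v [au bv ->]]] [s [t [as_ bt ->]]].
move=> [f_reg g_reg].
have [|c def_u] := g_reg u s.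
  rewrite mulrDl [in RHS]mulrDl.
  by rewrite [t * u]mulrC [v * s]mulrC (ab0 u t) // (ab0 s v) // !addr0 mulrC.
have w_vc : u * (1 - c) = v * c by rewrite mulrBr mulr1 {1}def_u; ring.
have w0 : u * (1 - c) = 0.
  apply: f_reg; have -> : (u + v) * (u * (1 - c)) = u * (u * (1 - c)) + u * v * (1 - c) by ring.
  by rewrite w_vc mulrA (ab0 u v) // !mul0r addr0.
have vc0 : v * c = 0 by rewrite -w_vc.
case: (local c) => -[d dc].
  have v0 : v = 0 by rewrite -[v]mulr1 -dc mulrCA vc0 mulr0.
  by apply: y0; apply: f_reg; rewrite v0 addr0 ab0.
have u0 : u = 0 by rewrite -[u]mulr1 -dc mulrCA w0 mulr0.
by apply: x0; apply: f_reg; rewrite u0 add0r mulrC ab0.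
Qed.

Lemma mem_ideal_gen_nil (x : A) : (x \in ideal_gen_seq [::]) = (x == 0).
Proof.
apply/idP/eqP => [/asboolP[[|u s] Ss ->]|->]; rewrite ?big_nil ?ideal_gen0 //.
by have := Ss u (mem_head _ _).
Qed.

Lemma mem_ideal_gen1 (f x : A) :
  x \in ideal_gen_seq [:: f] <-> exists y, x = f * y.
Proof.
split=> [/asboolP[s Ss ->]|[y ->]].
  rewrite big_seq; elim/big_rec: _ => [|u _ us [y ->]]; first by exists 0; rewrite mulr0.
  by have := Ss u us; rewrite inE => /eqP ->; exists (u.1 + y); ring.
apply/asboolP; exists [:: (y, f)]; last by rewrite big_seq1 mulrC.
by move=> u; rewrite inE => /eqP ->; rewrite inE.
Qed.

Lemma regular_seq_pair (s : seq A) : (1 < size s)%N -> regular_seq s ->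
  regular_pair s`_0 s`_1.
Proof.
case: s => [|f [|g s]] //= _ [_ reg]; split=> [x fx0|x y gx].
  have := reg 0%N x isT; rewrite /= !mem_ideal_gen_nil => /(_ _)/eqP; apply.
  exact/eqP.
apply/mem_ideal_gen1; have := reg 1%N x isT; apply => /=.
by rewrite gx; apply/mem_ideal_gen1; exists y.
Qed.

End RegularPair.

(** * Localizations and quotients *)

Section PrimeOfLocalization.
Variables (A : comNzRingType) (P : prime_idealr A).
Local Notation L := (localization P).

Definition to_loc (x : A) : L := \pi_L (x, Localization.den_one P).

Lemma loc_eqP (x y : A * Localization.den P) :
  \pi_L x = \pi_L y <->
  exists2 u : A, u \notin P & u * (x.1 * sval y.2) = u * (y.1 * sval x.2).
Proof.
split=> [/eqP|h]; last apply/eqP; rewrite Localization.equiv_def; first by move/asboolP.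
exact/asboolP.
Qed.

Lemma to_locD : {morph to_loc : x y / x + y}.
Proof.
move=> x y; rewrite /to_loc -[RHS]Localization.pi_add.
by apply: Localization.equivW; rewrite /=; ring.
Qed.
Lemma to_locM : {morph to_loc : x y / x * y}.
Proof.
move=> x y; rewrite /to_loc -[RHS]Localization.pi_mul.
by apply: Localization.equivW; rewrite /=; ring.
Qed.
Lemma to_loc1 : to_loc 1 = 1.
Proof. by rewrite /to_loc -[RHS]/(Localization.one P) /Localization.one; unlock. Qed.

Lemma to_locX x k : to_loc (x ^+ k) = to_loc x ^+ k.
Proof. by elim: k => [|k IHk]; rewrite ?expr0 ?to_loc1 // !exprS to_locM IHk. Qed.

Lemma to_loc_eq0 x : to_loc x = 0 <-> exists2 u : A, u \notin P & u * x = 0.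
Proof.
have -> : (0 : L) = to_loc 0.
  by rewrite /to_loc -[LHS]/(Localization.zero P) /Localization.zero; unlock.
rewrite loc_eqP /=; split=> -[u uP e]; exists u => //; move: e; rewrite /= ?mul0r ?mulr1 ?mulr0 //.
Qed.

Lemma locP (x : L) : exists r (s : Localization.den P), x = \pi_L (r, s).
Proof. by elim/quotW: x => -[r s]; exists r, s. Qed.

Lemma to_loc_unit s : s \notin P -> exists t, t * to_loc s = 1.
Proof.
move=> sP; exists (\pi_L (1, exist _ s sP)).
rewrite -[LHS]Localization.pi_mul -to_loc1.
by apply: Localization.equivW; rewrite /=; ring.
Qed.

(** Fractions in the form [to_loc r * t] with [t] inverse to [to_loc s], which
    allows computing in the localization with [to_loc] only. *)
Lemma loc_frac (x : L) : exists r s t,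
  [/\ s \notin P, t * to_loc s = 1, x = to_loc r * t & x * to_loc s = to_loc r].
Proof.
have [r [[s sP] ->]] := locP x; have [t ts] := to_loc_unit sP.
have e : \pi_L (r, exist _ s sP) * to_loc s = to_loc r.
  rewrite -[LHS]Localization.pi_mul.
  by apply: Localization.equivW; rewrite /=; ring.
by exists r, s, t; split=> //; rewrite -e -mulrA [to_loc s * t]mulrC ts mulr1.
Qed.

Lemma loc_local (c : L) : (exists d, d * c = 1) \/ (exists d, d * (1 - c) = 1).
Proof.
have [r [s [t [sP ts def_c _]]]] := loc_frac c.
have [rP | rP] := boolP (r \in P); last first.
  left; have [d dr] := to_loc_unit rP; exists (d * to_loc s).
  by rewrite def_c mulrACA dr mul1r mulrC.
right; have [|d dsr] := @to_loc_unit (s - r).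
  by apply: contra sP => srP; rewrite -(subrK r s) rpredD.
exists (d * to_loc s); rewrite mulrBr mulr1 def_c mulrACA -[to_loc s * t]mulrC ts mulr1.
rewrite -mulrBr; have -> : to_loc s - to_loc r = to_loc (s - r); last by [].
by apply/eqP; rewrite subr_eq -to_locD subrK.
Qed.

Lemma mem_idealr_loc (m : idealr L) (x : L) : x \in m ->
  exists r s t, [/\ r \in P, t * to_loc s = 1 & x = to_loc r * t].
Proof.
move=> xm; have [r [s [t [sP ts def_x xs]]]] := loc_frac x.
exists r, s, t; split=> //; apply: contraT => /to_loc_unit[d dr].
have : d * to_loc r \in m by rewrite -xs mulrA mulrAC idealMr.
by rewrite dr idealr1.
Qed.

Section Contracted.
Variables (q : prime_idealr A) (qP : {subset q <= P}).

(** The extension of [q] to the localization, read off any representative of a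
    fraction: since [q] is below [P], numerators of equal fractions are in [q] or
    not simultaneously. *)
Definition loc_pred : {pred L} := fun x => (repr x).1 \in q.

Lemma mem_loc_pred r s : (\pi_L (r, s) \in loc_pred) = (r \in q).
Proof.
have /asboolP[u uP /=] := Localization.equiv_repr (r, s).
set x := repr _ => e; rewrite unfold_in -/x.
have nq w : w \notin P -> (w \in q) = false by move=> /(contra (@qP w))/negbTE.
have : (u * (x.1 * sval s) \in q) = (u * (r * sval x.2) \in q) by rewrite e.
by rewrite !prime_idealrM (nq u uP) (nq _ (svalP s)) (nq _ (svalP x.2)) /= !orbF.
Qed.

Lemma to_loc_pred r : (to_loc r \in loc_pred) = (r \in q).
Proof. exact: mem_loc_pred. Qed.

Lemma loc_pred_idealr : idealr_closed loc_pred.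
Proof.
split; first by have /to_loc_eq0 <- : exists2 u, u \notin P & u * (0 : A) = 0;
  rewrite ?to_loc_pred ?idealr0 //; exists 1; rewrite ?idealr1 ?mulr0.
- by rewrite -to_loc1 to_loc_pred idealr1.
move=> a x y; have [ra [sa ->]] := locP a; have [rx [sx ->]] := locP x.
have [ry [sy ->]] := locP y; rewrite !mem_loc_pred => xq yq.
rewrite -[_ * _]Localization.pi_mul -[_ + _]Localization.pi_add mem_loc_pred /=.
by rewrite rpredD // mulrC !idealMr.
Qed.

Lemma loc_pred_prime : prime_idealr_closed loc_pred.
Proof.
move=> x y; have [rx [sx ->]] := locP x; have [ry [sy ->]] := locP y.
by rewrite -[_ * _]Localization.pi_mul !mem_loc_pred /= prime_idealrM.
Qed.

Definition loc_prime : prime_idealr L :=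
  HB.pack_for (prime_idealr L) (loc_pred : L -> bool)
    (isIdealr.Build L loc_pred loc_pred_idealr)
    (isPrimeIdealrClosed.Build L loc_pred loc_pred_prime).

End Contracted.

End PrimeOfLocalization.

Section PrimeOfQuotient.
Variables (R : comNzRingType) (I : idealr R) (q : prime_idealr R).
Hypothesis Iq : {subset I <= q}.
Local Notation A := {ideal_quot I}.

Definition quot_pred : {pred A} := fun x => repr x \in q.

Lemma mem_quot_pred x : (\pi_A x \in quot_pred) = (x \in q).
Proof.
have : \pi_A (repr (\pi_A x)) = \pi_A x by rewrite reprK.
move/eqP; rewrite -Quotient.idealrBE => /Iq yxq.
rewrite -[LHS]/(repr (\pi_A x) \in q); move: (repr _) yxq => y yxq.
by apply/idP/idP => [yq|xq]; [rewrite -(subKr y x) rpredB | rewrite -(subrK x y) rpredD].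
Qed.

Lemma quot_pred_idealr : idealr_closed quot_pred.
Proof.
split; first by rewrite -(rmorph0 \pi_A) mem_quot_pred idealr0.
  by rewrite -(rmorph1 \pi_A) mem_quot_pred idealr1.
move=> a x y; elim/quotW: a => a; elim/quotW: x => x; elim/quotW: y => y.
by rewrite -rmorphM -rmorphD !mem_quot_pred => xq yq; rewrite rpredD // idealMr.
Qed.

Lemma quot_pred_prime : prime_idealr_closed quot_pred.
Proof.
move=> x y; elim/quotW: x => x; elim/quotW: y => y.
by rewrite -rmorphM !mem_quot_pred prime_idealrM.
Qed.

Definition quot_prime : prime_idealr A :=
  HB.pack_for (prime_idealr A) (quot_pred : A -> bool)
    (isIdealr.Build A quot_pred quot_pred_idealr)
    (isPrimeIdealrClosed.Build A quot_pred quot_pred_prime).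

End PrimeOfQuotient.
(** * A criterion for not being Cohen-Macaulay *)

Section Connectedness.
Implicit Types (A R : comNzRingType).

Lemma prime_chain2 A (P0 P1 P2 : prime_idealr A) :
  {subset P0 <= P1} -> ~ {subset P1 <= P0} ->
  {subset P1 <= P2} -> ~ {subset P2 <= P1} -> prime_chain A 2.
Proof.
move=> s01 n10 s12 n21; exists (nth P0 [:: P0; P1; P2]) => -[|[|i]] //.
Qed.

(** The chain of primes forces the dimension, hence the length of some regular
    sequence, to be at least two, which [no_regular_pair] forbids. *)
Lemma localization_not_cm A (P q0 q1 : prime_idealr A) (J1 J2 : A -> Prop) :
  {subset q0 <= q1} -> {subset q1 <= P} ->
  (exists2 x, x \in q1 & x \notin q0) -> (exists2 x, x \in P & x \notin q1) ->
  (forall x y, J1 x -> J2 y -> exists2 w, w \notin P & w * (x * y) = 0) ->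
  (exists2 x, J1 x & forall w, w \notin P -> w * x <> 0) ->
  (exists2 y, J2 y & forall w, w \notin P -> w * y <> 0) ->
  (forall f, f \in P -> exists k u v, [/\ J1 u, J2 v & f ^+ k = u + v]) ->
  ~ cohen_macaulay_local (localization P).
Proof.
move=> s01 s1P [x1 x1q1 x1q0] [x2 x2P x2q1] J12 [x J1x xN0] [y J2y yN0] JP.
case=> _ [m _ [d [[s [sm reg <-]] _] [_ dimP]]].
pose ext (J : A -> Prop) (z : localization P) :=
  exists u c, J u /\ z = to_loc P u * c.
have extP z : z \in m -> exists k u v, [/\ ext J1 u, ext J2 v & z ^+ k = u + v].
  move=> /mem_idealr_loc[r [w [t [rP _ ->]]]]; have [k [u [v [Ju Jv e]]]] := JP r rP.
  exists k, (to_loc P u * t ^+ k), (to_loc P v * t ^+ k); split.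
  - by exists u, (t ^+ k).
  - by exists v, (t ^+ k).
  by rewrite exprMn -to_locX e to_locD mulrDl.
have ss : (1 < size s)%N.
  apply: dimP; have s0P z : z \in q0 -> z \in P by move/s01/s1P.
  apply: (@prime_chain2 _ (loc_prime s0P) (loc_prime s1P) (loc_prime (fun z (h : z \in P) => h))).
  - by move=> z; have [r [w ->]] := locP z; rewrite !mem_loc_pred //; apply: s01.
  - by move/(_ (to_loc P x1)); rewrite !to_loc_pred // (negPf x1q0) => /(_ x1q1).
  - by move=> z; have [r [w ->]] := locP z; rewrite !mem_loc_pred //; apply: s1P.
  by move/(_ (to_loc P x2)); rewrite !to_loc_pred // (negPf x2q1) => /(_ x2P).
have [k [u [v uv]]] := extP s`_0 (sm _ (mem_nth _ (ltnW ss))).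
have [k' [u' [v' uv']]] := extP s`_1 (sm _ (mem_nth _ ss)).
apply: (@no_regular_pair _ (ext J1) (ext J2) (s`_0 ^+ k) (s`_1 ^+ k')).
- exact: loc_local.
- move=> z z' [a [c [Ja ->]]] [b [c' [Jb ->]]].
  rewrite mulrACA -to_locM; have /to_loc_eq0 -> := J12 _ _ Ja Jb; exact: mul0r.
- exists (to_loc P x); first by exists x, 1; rewrite mulr1.
  by move=> /to_loc_eq0[w wP /xN0]; apply.
- exists (to_loc P y); first by exists y, 1; rewrite mulr1.
  by move=> /to_loc_eq0[w wP /yN0]; apply.
- by exists u, v.
- by exists u', v'.
exact/regular_pair_exp/regular_seq_pair.
Qed.

(** The same criterion in terms of a ring [R] above the quotient.  The primes
    [q2] and [q0] serve to show that [J1] and [J2] do not vanish locally: they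
    contain [I], so elements outside them stay nonzero in the localization. *)
Lemma quotient_not_cm R (I : idealr R) (p q0 q1 q2 : prime_idealr R) (J1 J2 : R -> Prop) :
  {subset I <= q0} -> {subset I <= q2} ->
  {subset q0 <= q1} -> {subset q1 <= p} -> {subset q2 <= p} ->
  (exists2 x, x \in q1 & x \notin q0) -> (exists2 x, x \in p & x \notin q1) ->
  (forall x y, J1 x -> J2 y -> exists2 w, w \notin p & w * (x * y) \in I) ->
  (exists2 x, J1 x & x \notin q2) ->
  (exists2 y, J2 y & y \notin q0) ->
  (forall f, f \in p -> exists k u v, [/\ J1 u, J2 v & f ^+ k = u + v]) ->
  ~ cohen_macaulay {ideal_quot I}.
Proof.
move=> Iq0 Iq2 s01 s1p s2p [x1 x1q1 x1q0] [x2 x2p x2q1] J12 [x J1x xq2] [y J2y yq0] Jp.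
case=> _ cm; have Iq1 z : z \in I -> z \in q1 by move/Iq0/s01.
have Ip z : z \in I -> z \in p by move/Iq1/s1p.
pose pr z := \pi_{ideal_quot I} z; have prK z : exists x, z = pr x.
  by elim/quotW: z => z; exists z.
pose ext (J : R -> Prop) z := exists2 u, J u & z = pr u.
have pr_eq0 z : pr z = 0 <-> z \in I.
  rewrite -{2}[z]subr0 Quotient.idealrBE -(rmorph0 \pi_{ideal_quot I}).
  by split=> /eqP.
apply: (@localization_not_cm _ (quot_prime Ip) (quot_prime Iq0) (quot_prime Iq1)
  (ext J1) (ext J2)) (cm _).
- by move=> z; have [z' ->] := prK z; rewrite !mem_quot_pred //; apply: s01.
- by move=> z; have [z' ->] := prK z; rewrite !mem_quot_pred //; apply: s1p.
- by exists (pr x1); rewrite mem_quot_pred //.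
- by exists (pr x2); rewrite mem_quot_pred //.
- move=> _ _ [u Ju ->] [v Jv ->]; have [w wp wI] := J12 u v Ju Jv.
  by exists (pr w); rewrite ?mem_quot_pred // -!rmorphM; apply/pr_eq0.
- exists (pr x) => [|w]; first by exists x.
  have [w' ->] := prK w; rewrite mem_quot_pred // -rmorphM => w'p /pr_eq0/Iq2.
  by rewrite prime_idealrM (negPf xq2) orbF => /s2p; rewrite (negPf w'p).
- exists (pr y) => [|w]; first by exists y.
  have [w' ->] := prK w; rewrite mem_quot_pred // -rmorphM => w'p /pr_eq0/Iq0.
  by rewrite prime_idealrM (negPf yq0) orbF => /s01/s1p; rewrite (negPf w'p).
move=> z; have [f ->] := prK z; rewrite mem_quot_pred // => /Jp[k [u [v [Ju Jv e]]]].
exists k, (pr u), (pr v); split; [by exists u | by exists v |].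
by rewrite -rmorphXn e rmorphD.
Qed.

End Connectedness.
(** * Ideals of subspaces where blocks of coordinates agree *)

Section Collapse.
Variables (K : fieldType) (n : nat).
Local Notation R := {mpoly K[n]}.
Implicit Types (r : 'I_n -> 'I_n) (f g : R) (i j : 'I_n).

(** Identifying variables along [r]; when [r] is idempotent, this is restriction
    to the subspace where coordinates with the same image under [r] agree. *)
Definition collapse r f : R := f \mPo [tuple 'X_(r i) | i < n].

HB.instance Definition _ r := GRing.RMorphism.copy (collapse r)
  (comp_mpoly [tuple 'X_(r i) | i < n] : R -> R).

Lemma collapseX r i : collapse r 'X_i = 'X_(r i).
Proof. by rewrite /collapse comp_mpolyXU -tnth_nth tnth_mktuple. Qed.

Lemma collapseZ r c f : collapse r (c *: f) = c *: collapse r f.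
Proof. exact: comp_mpolyZ. Qed.

(** The kernel of an idempotent [collapse r] is generated by the differences
    X_i - X_(r i); phrased for any ideal-like predicate, so that no explicit linear
    combination has to be handled. *)
Lemma mem_sub_collapse (Q : R -> Prop) r :
  Q 0 -> (forall f g, Q f -> Q g -> Q (f + g)) ->
  (forall c f, Q f -> Q (c * f)) -> (forall i, Q ('X_i - 'X_(r i))) ->
  forall f, Q (f - collapse r f).
Proof.
move=> Q0 QD QM QX; have QC c : Q (c%:MP - collapse r c%:MP).
  by rewrite /collapse comp_mpolyC subrr.
have Qmul f g : Q (f - collapse r f) -> Q (g - collapse r g) ->
    Q (f * g - collapse r (f * g)).
  move=> Qf Qg; have -> : f * g - collapse r (f * g) =
      g * (f - collapse r f) + collapse r f * (g - collapse r g).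
    by rewrite rmorphM; ring.
  by apply: QD; apply: QM.
move=> f; rewrite [f]mpolyE.
elim/big_rec: _ => [|m g _ IHg]; first by rewrite rmorph0 subrr.
rewrite rmorphD opprD addrACA; apply: (QD _ _ _ IHg); rewrite -mul_mpolyC.
apply: (Qmul _ _ (QC _)); rewrite mpolyXE_id.
elim/big_rec: _ => [|i h _ IHh]; first by rewrite rmorph1 subrr.
apply: (Qmul _ _ _ IHh); elim: (m i) => [|k IHk]; first by rewrite rmorph1 subrr.
by rewrite exprS; apply: (Qmul _ _ _ IHk); rewrite collapseX; exact: QX.
Qed.

Lemma mpolyX_inj i j : 'X_i = 'X_j :> R -> i = j.
Proof.
move=> /(congr1 (meval (fun k => (k == i)%:R))); rewrite !mevalXU eqxx.
by case: eqP => // _ /eqP; rewrite oner_eq0.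
Qed.

Lemma collapse_comp r r' r'' f : (forall i, r' (r i) = r'' i) ->
  collapse r' (collapse r f) = collapse r'' f.
Proof.
move=> e; have coll_prod r0 m : collapse r0 'X_[m] = \prod_(i < n) 'X_(r0 i) ^+ m i.
  by rewrite /collapse comp_mpolyX; apply: eq_bigr => i _; rewrite tnth_mktuple.
rewrite (mpolyE f) (raddf_sum (collapse r) _) (raddf_sum (collapse r') _) (raddf_sum (collapse r'') _).
apply: eq_bigr => m _ /=.
rewrite !collapseZ; congr (_ *: _); rewrite !coll_prod rmorph_prod.
by apply: eq_bigr => i _ /=; rewrite rmorphXn /= collapseX e.
Qed.

Definition collapse_ker r : {pred R} := fun f => collapse r f == 0.

Lemma mem_collapse_ker r f : (f \in collapse_ker r) = (collapse r f == 0).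
Proof. by []. Qed.

Lemma collapse_ker_idealr r : idealr_closed (collapse_ker r).
Proof.
split=> [||a f g]; rewrite !mem_collapse_ker; first by rewrite rmorph0.
  by rewrite rmorph1 oner_eq0.
by move=> /eqP f0 /eqP g0; rewrite rmorphD rmorphM /= f0 g0 mulr0 addr0.
Qed.

Lemma collapse_ker_prime r : prime_idealr_closed (collapse_ker r).
Proof. by move=> f g; rewrite !mem_collapse_ker rmorphM mulf_eq0. Qed.

Definition collapse_prime r : prime_idealr R :=
  HB.pack_for (prime_idealr R) (collapse_ker r : R -> bool)
    (isIdealr.Build R (collapse_ker r) (@collapse_ker_idealr r))
    (isPrimeIdealrClosed.Build R (collapse_ker r) (@collapse_ker_prime r)).

Lemma mem_collapse_prime r f : (f \in collapse_prime r) = (collapse r f == 0).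
Proof. by []. Qed.

Lemma mem_collapse_primeX r i j : ('X_i - 'X_j \in collapse_prime r) = (r i == r j).
Proof.
rewrite mem_collapse_prime rmorphB /= !collapseX subr_eq0.
by apply/eqP/eqP => [/mpolyX_inj|->].
Qed.

Lemma sub_collapse_prime r r' : (forall i, r' (r i) = r' i) ->
  {subset collapse_prime r <= collapse_prime r'}.
Proof.
move=> e f fr; rewrite mem_collapse_prime -(collapse_comp f e).
by rewrite mem_collapse_prime in fr; rewrite (eqP fr) rmorph0.
Qed.

Section Saturation.
Variables (I : idealr R) (p : prime_idealr R).

(** The contraction to the ring of the extension of [I] to the localization at
    [p]. *)
Definition saturation f : Prop := exists2 w, w \notin p & w * f \in I.

Lemma saturation0 : saturation 0.
Proof. by exists 1; rewrite ?mulr0 ?idealr0 // idealr1. Qed.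

Lemma saturationD f g : saturation f -> saturation g -> saturation (f + g).
Proof.
move=> [w wp wf] [v vp vg]; exists (w * v); first by rewrite prime_idealrM negb_or wp.
have -> : w * v * (f + g) = v * (w * f) + w * (v * g) by ring.
by rewrite rpredD // idealMr.
Qed.

Lemma saturationM c f : saturation f -> saturation (c * f).
Proof. by move=> [w wp wf]; exists w => //; rewrite mulrCA idealMr. Qed.

Lemma saturation_collapse_ker r h :
  (forall i, saturation (('X_i - 'X_(r i)) * h)) ->
  forall f, f \in collapse_prime r -> saturation (f * h).
Proof.
move=> sat_gen f; rewrite mem_collapse_prime => /eqP f0.
rewrite -[f]subr0 -f0.
apply: (@mem_sub_collapse (fun x => saturation (x * h))) => //.
- by rewrite mul0r; apply: saturation0.
- by move=> x y sx sy; rewrite mulrDl; apply: saturationD.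
by move=> c x sx; rewrite -mulrA; apply: saturationM.
Qed.

End Saturation.
End Collapse.
(** * Tableaux and the pigeonhole principle *)

Section Tableaux.
Variables (n : nat) (la : seq nat).
Hypothesis hla : is_partition n la.
Implicit Types (T : tableau n la) (x y : 'I_n) (s : {perm 'I_n}).
Local Notation len i := (nth 0%N la i).

Lemma partition_nth_ge i j : (i <= j)%N -> (len j <= len i)%N.
Proof.
move=> ij; have [jl|lj] := ltnP j (size la); last by rewrite nth_default.
case/and3P: hla => sla _ _.
have geq_trans : transitive geq by move=> y x z yx zy; apply: leq_trans zy yx.
by apply: (sorted_leq_nth geq_trans (leqnn : reflexive geq) _ sla) => //; apply: leq_ltn_trans jl.
Qed.

Lemma partition_size_gt1 : (0 < n)%N -> la <> [:: n] -> (1 < size la)%N.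
Proof.
case: la hla => [|a [|b l]] // /and3P[_ _ /eqP <-] //= _ ne.
by case: ne; rewrite addn0.
Qed.

Lemma tableau_exists : exists T : tableau n la, True.
Proof.
case/and3P: hla => _ _ /eqP sla.
have card_box : #|{: {i : 'I_(size la) & 'I_(len i)}}| = n.
  rewrite card_tagged -[RHS]sla !sumnE big_map big_enum /= [RHS](big_nth 0%N) big_mkord.
  by apply: eq_bigr => i _; rewrite card_ord.
pose f x : box la := enum_val (cast_ord (esym card_box) x).
have f_bij : bijective f.
  apply: (@bij_comp _ _ _ (@enum_val _ _)); first exact: enum_val_bij.
  by exists (cast_ord card_box) => z; rewrite ?cast_ordK ?cast_ordKV.
by exists (Tableau f_bij).
Qed.

Lemma col_lt T x : (col_of T x < len (row_of T x))%N.
Proof. exact: ltn_ord. Qed.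

Lemma col_lt0 T x : (col_of T x < len 0)%N.
Proof. by apply: leq_trans (col_lt T x) _; apply: partition_nth_ge. Qed.

Lemma box_inj T x y :
  row_of T x = row_of T y -> col_of T x = col_of T y -> x = y.
Proof.
move=> r c; apply: (bij_inj (tab_bij T)); move: r c; rewrite /row_of /col_of.
case: (T x) (T y) => [i c] [i' c'] /= /val_inj e; case: _ / e c' => c' /val_inj ->.
by [].
Qed.

Lemma box_filled T i j : (j < len i)%N ->
  exists x, row_of T x = i /\ col_of T x = j.
Proof.
move=> ji; have il : (i < size la)%N.
  by rewrite ltnNge; apply: contraL ji => li; rewrite nth_default.
have [T' TK T'K] := tab_bij T.
exists (T' (@Tagged _ (Ordinal il) (fun k : 'I_(size la) => 'I_(len k)) (Ordinal ji))).
by rewrite /row_of /col_of T'K.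
Qed.

Definition row_set T i : {set 'I_n} := [set x | row_of T x == i].

Lemma card_row_set T i : #|row_set T i| = len i.
Proof.
have box_at (j : 'I_(len i)) : exists x, (row_of T x == i) && (col_of T x == j).
  by have [x [rx cx]] := box_filled T (ltn_ord j); exists x; rewrite rx cx !eqxx.
pose g j := xchoose (box_at j).
have gP j : row_of T (g j) = i /\ col_of T (g j) = j.
  by have /andP[/eqP ? /eqP ?] := xchooseP (box_at j).
have g_inj : injective g.
  by move=> j k e; apply: ord_inj; rewrite -(gP j).2 e (gP k).2.
rewrite -[RHS]card_ord -cardsT -(card_imset _ g_inj); apply: eq_card => x.
rewrite inE; apply/eqP/imsetP => [rx|[j _ ->]]; last by case: (gP j).
have cx : (col_of T x < len i)%N by rewrite -rx col_lt.
have [rg cg] := gP (Ordinal cx).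
by exists (Ordinal cx); rewrite ?inE //; apply: (@box_inj T); rewrite ?rg ?cg.
Qed.

Lemma same_column T (F : {set 'I_n}) : (len 0 < #|F|)%N ->
  exists x y, [/\ x \in F, y \in F, x != y & col_of T x = col_of T y].
Proof.
move=> cF; apply: contrapT => no.
have : (#|F| <= #|'I_(len 0)|)%N.
  rewrite -(@card_in_imset _ _ (fun x => Ordinal (col_lt0 T x)) F) ?max_card //.
  move=> x y xF yF [] exy; apply: contrapT => /eqP nxy; apply: no.
  by exists x, y.
by rewrite card_ord leqNgt cF.
Qed.

(** If each column contained at most one element of F and at most one of G, then
    each of the first [len 1] columns would contain at most two elements of the
    union and each of the other ones, which have length one, at most one: at most
    [len 0 + len 1] in total.  The map [h] in the proof numbers these places. *)
Lemma same_column2 T (F G : {set 'I_n}) : (len 0 + len 1 < #|F :|: G|)%N ->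
  exists x y, [/\ (x \in F) && (y \in F) || (x \in G) && (y \in G), x != y
                & col_of T x = col_of T y].
Proof.
move=> cFG; apply: contrapT => no.
pose h x := if (col_of T x < len 1)%N && (x \in F) then (len 0 + col_of T x)%N else col_of T x.
have h_lt x : (h x < len 0 + len 1)%N.
  rewrite /h; case: ifP => [/andP[c _]|_]; first by rewrite ltn_add2l.
  by rewrite ltn_addr ?col_lt0.
have : (#|F :|: G| <= #|'I_(len 0 + len 1)|)%N.
  rewrite -(@card_in_imset _ _ (fun x => Ordinal (h_lt x)) (F :|: G)) ?max_card //.
  move=> x y xFG yFG [] hxy; apply: contrapT => /eqP nxy.
  have [cxy FGxy] : col_of T x = col_of T y /\
      ((col_of T x < len 1)%N -> (x \in F) = (y \in F)).
    move: hxy; rewrite /h; have := col_lt0 T x; have := col_lt0 T y.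
    case: (x \in F); case: (y \in F); rewrite ?andbT ?andbF;
      by case: (ltnP (col_of T x) (len 1)) => ?; case: (ltnP (col_of T y) (len 1)) => ? /=; lia.
  have [cx|cx] := ltnP (col_of T x) (len 1).
    apply: no; exists x, y; split=> //; have := FGxy cx.
    by move: xFG yFG; rewrite !inE; do 2 case: (_ \in F) => //=; move=> -> ->.
  have row0 z : (len 1 <= col_of T z)%N -> row_of T z = 0%N.
    case E: (row_of T z) => [//|k] cz.
    by have := col_lt T z; have := @partition_nth_ge 1 k.+1 isT; rewrite E; lia.
  by move/eqP: nxy; apply; apply: (@box_inj T); rewrite ?row0 // -cxy.
by rewrite card_ord leqNgt cFG.
Qed.

Lemma perm_tableau_bij T s : bijective (fun x => T (s x)).
Proof. exact: bij_comp (tab_bij T) (injF_bij (@perm_inj _ s)). Qed.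

Definition perm_tableau T s : tableau n la := Tableau (perm_tableau_bij T s).

Lemma row_of_perm T s x : row_of (perm_tableau T s) x = row_of T (s x).
Proof. by []. Qed.

Lemma col_of_perm T s x : col_of (perm_tableau T s) x = col_of T (s x).
Proof. by []. Qed.

End Tableaux.
(** * Specht polynomials in a localization *)

Section SpechtLocal.
Variables (K : fieldType) (n : nat) (la : seq nat).
Hypotheses (hn : (2 <= n)%N) (hla : is_partition n la) (hne : la <> [:: n]).
Local Notation R := {mpoly K[n]}.
Local Notation len i := (nth 0%N la i).
Local Notation I := (specht_ideal K hn hla hne).
Implicit Types (T : tableau n la) (r : 'I_n -> 'I_n) (x y : 'I_n) (Z : {set 'I_n * 'I_n}).

Definition below T : {set 'I_n * 'I_n} :=
  [set e | (col_of T e.1 == col_of T e.2) && (row_of T e.1 < row_of T e.2)%N].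

Definition diff_prod Z : R := \prod_(e in Z) ('X_e.1 - 'X_e.2).

Lemma specht_polyE T : specht_poly K T = diff_prod (below T).
Proof.
rewrite /specht_poly /specht_col exchange_big /= /diff_prod.
rewrite (eq_bigl (fun e : 'I_n * 'I_n => true && 
  ((col_of T e.1 == col_of T e.2) && (row_of T e.1 < row_of T e.2)%N))); last by move=> e; rewrite inE.
rewrite -(pair_big_dep xpredT (fun a b => (col_of T a == col_of T b) && (row_of T a < row_of T b)%N)
  (fun a b => 'X_a - 'X_b)) /=; apply: eq_bigr => a _.
rewrite (bigD1 (Ordinal (col_lt0 hla T a))) //= [X in _ * X]big1 ?mulr1 => [|j ja].
  by apply: eq_bigl => b; rewrite eqxx /= [col_of T b == _]eq_sym.
rewrite big_pred0 // => b; apply/negbTE; apply: contra ja => /andP[/eqP e _].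
by apply/eqP/val_inj.
Qed.

Lemma mem_specht_poly T : specht_poly K T \in I.
Proof.
rewrite unfold_in; apply/asboolP; exists [:: (1, specht_poly K T)].
  by move=> u; rewrite inE => /eqP ->; exists T.
by rewrite big_seq1 mul1r.
Qed.

Lemma diff_prod_notin r Z : (forall e, e \in Z -> r e.1 != r e.2) ->
  diff_prod Z \notin collapse_prime K r.
Proof.
move=> h; rewrite mem_collapse_prime rmorph_prod; apply/prodf_neq0 => e /h.
by rewrite -mem_collapse_prime mem_collapse_primeX.
Qed.

Lemma specht_sub_collapse r :
  (forall T, exists x y, [/\ x != y, col_of T x = col_of T y & r x = r y]) ->
  {subset I <= collapse_prime K r}.
Proof.
move=> h f; rewrite unfold_in => /asboolP[s Ss ->]; rewrite big_seq.
apply: rpred_sum => u us; rewrite idealMr //; have [T ->] := Ss u us.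
have [x [y [nxy cxy rxy]]] := h T.
rewrite specht_polyE mem_collapse_prime rmorph_prod; apply/prodf_eq0.
have [lt|ge] := ltnP (row_of T x) (row_of T y).
  exists (x, y); first by rewrite inE cxy eqxx.
  by rewrite -mem_collapse_prime mem_collapse_primeX rxy.
exists (y, x); last by rewrite -mem_collapse_prime mem_collapse_primeX rxy.
rewrite inE cxy eqxx ltn_neqAle ge andbT; apply: contra nxy => /eqP e.
exact/eqP/(@box_inj _ _ T).
Qed.

(** If the factors X_x - X_y of the Specht polynomial of T which are not units at
    the prime are among those of [diff_prod Z], then [diff_prod Z] is locally a
    multiple of that Specht polynomial. *)
Lemma saturation_diff_prod T r Z :
  (forall x y, (x, y) \in below T -> r x = r y -> (x, y) \in Z) ->
  saturation I (collapse_prime K r) (diff_prod Z).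
Proof.
move=> h; exists (diff_prod (below T :\: Z)).
  apply: diff_prod_notin => -[x y]; rewrite in_setD /= => /andP[nZ xyT].
  by apply: contra nZ => /eqP; apply: h.
have -> : diff_prod (below T :\: Z) * diff_prod Z =
    diff_prod (Z :\: below T) * diff_prod (below T).
  rewrite /diff_prod (big_setID (below T) (A := Z)) (big_setID Z (A := below T)) /= setIC.
  by ring.
by rewrite idealMr // -specht_polyE mem_specht_poly.
Qed.

End SpechtLocal.
Lemma row_tperm n la (T : tableau n la) x y z :
  row_of T x = row_of T y -> row_of T (tperm x y z) = row_of T z.
Proof. by move=> e; case: tpermP => // ->. Qed.

Lemma row_neq n la (T : tableau n la) x y : row_of T x != row_of T y -> x != y.
Proof. by apply: contra => /eqP ->. Qed.
(** * First two rows of equal length *)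

Section EqualRows.
Variables (K : fieldType) (n : nat) (la : seq nat).
Hypotheses (hn : (2 <= n)%N) (hla : is_partition n la) (hne : la <> [:: n]).
Local Notation len i := (nth 0%N la i).
Local Notation I := (specht_ideal K hn hla hne).

(** The block F consists of the first row of a tableau T and its entry e in the
    first box of the third row, the block G of the second row and another entry l
    below it.  Both blocks have [len 0 + 1] elements, so the Specht ideal vanishes
    on V_F and on V_G.  Moving an element x of the first row above e, and an
    element y of the second row above l, makes (x, e) and (y, l) the only pairs in
    a column within a block.  So (X_x - X_e)(X_y - X_l) belongs to the Specht
    ideal locally, and so does the product of the ideals of V_F and V_G. *)
Lemma not_cm_equal_rows (i j : nat) :
  len 0 = len 1 -> (2 <= len 1)%N -> (0 < len 2)%N ->
  (j < len i.+2)%N -> (i, j) != (0, 0)%N ->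
  ~ cohen_macaulay {ideal_quot I}.
Proof.
move=> len01 len1 len2 ji ij0.
have [T _] := tableau_exists hla.
have [e [re ce]] := box_filled T len2; have [l [rl cl]] := box_filled T ji.
have j1 : (j < len 1)%N by apply: leq_trans ji (partition_nth_ge hla _).
have [i0 [ri0 ci0]] := @box_filled _ _ T 0 0 (leq_trans (ltnW len1) (eq_leq (esym len01))).
have [k0 [rk0 ck0]] := box_filled T j1.
have [k1 [rk1 ck1]] := @box_filled _ _ T 1 0 (ltnW len1).
have [k2 [rk2 ck2]] := box_filled T len1.
have el : e != l.
  by apply: contra ij0 => /eqP el; move: rl cl; rewrite -el re ce => -[<-] <-.
pose F := e |: row_set T 0; pose G := l |: row_set T 1.
have inF z : (z \in F) = (z == e) || (row_of T z == 0%N) by rewrite !inE.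
have inG z : (z \in G) = (z == l) || (row_of T z == 1%N) by rewrite !inE.
(* The prime [q0] is that of [rF], [q1] that of [r1], [p] that of [rp]: the last
   identifies all of G, while [r1] identifies only k1 and l, leaving k2 apart. *)
pose rF z := if z \in F then e else z; pose rG z := if z \in G then l else z.
pose rp z := if z \in F then e else rG z.
pose r1 z := if z \in F then e else if z == k1 then l else z.
have rowN x y : row_of T x != row_of T y -> x == y = false.
  by move=> nxy; apply/negbTE/(row_neq (T := T)).
have eF : e \in F by rewrite inF eqxx.
have lG : l \in G by rewrite inG eqxx.
have eG : e \notin G by rewrite inG (negPf el) re.
have lF : l \notin F by rewrite inF eq_sym (negPf el) rl.
have FG z : z \in F -> z \in G = false.
  by rewrite inF => /orP[/eqP->|/eqP rz]; rewrite ?(negPf eG) // inG rz rowN // rz rl.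
have k1l : k1 == l = false by apply: rowN; rewrite rk1 rl.
have k2l : k2 == l = false by apply: rowN; rewrite rk2 rl.
have lk1 : l == k1 = false by rewrite eq_sym.
have k12 : k2 == k1 = false by apply/eqP => k12; move: ck2; rewrite k12 ck1.
have k1F : k1 \in F = false by rewrite inF rk1 rowN // rk1 re.
have k2F : k2 \in F = false by rewrite inF rk2 rowN // rk2 re.
have k1G : k1 \in G by rewrite inG rk1 orbT.
have k2G : k2 \in G by rewrite inG rk2 orbT.
have i0F : i0 \in F by rewrite inF ri0 orbT.
have i0e : i0 == e = false by apply: rowN; rewrite ri0 re.
have same_block x y : rp x = rp y ->
    [\/ x = y, x \in F /\ y \in F | x \in G /\ y \in G].
  rewrite /rp /rG; case xF: (x \in F); case yF: (y \in F); first by constructor 2.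
  - by case: ifP => yG exy; [rewrite exy eqxx in el | rewrite -exy eF in yF].
  - by case: ifP => xG exy; [rewrite -exy eqxx in el | rewrite exy eF in xF].
  case xG: (x \in G); case yG: (y \in G) => exy; [by constructor 3| | |by constructor 1].
    by rewrite -exy lG in yG.
  by rewrite exy lG in xG.
have sub_F : {subset I <= collapse_prime K rF}.
  apply: specht_sub_collapse => T'.
  have [|x [y [xF yF nxy cxy]]] := @same_column _ _ hla T' F.
    by rewrite cardsU1 card_row_set inE re.
  by exists x, y; split=> //; rewrite /rF xF yF.
have sub_G : {subset I <= collapse_prime K rG}.
  apply: specht_sub_collapse => T'.
  have [|x [y [xG yG nxy cxy]]] := @same_column _ _ hla T' G.
    by rewrite cardsU1 card_row_set inE rl len01.
  by exists x, y; split=> //; rewrite /rG xG yG.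
have rp_rF z : rG (rF z) = rp z.
  by rewrite /rp /rF; case: ifP => // _; rewrite /rG (negPf eG).
have sat_xy x y : row_of T x = 0%N -> row_of T y = 1%N ->
    saturation I (collapse_prime K rp) (('X_x - 'X_e) * ('X_y - 'X_l)).
  move=> rx ry.
  (* The tableau T' is T with x moved above e and y moved above l; [s] sends an
     entry to the one whose box it takes. *)
  pose s z := tperm y k0 (tperm x i0 z).
  pose T' := perm_tableau (perm_tableau T (tperm y k0)) (tperm x i0).
  have rT' z : row_of T' z = row_of T z.
    by rewrite !row_of_perm !row_tperm ?row_of_perm ?row_tperm // ?ry ?rx.
  have cT' z : col_of T' z = col_of T (s z) by [].
  have s_e : s e = e by rewrite /s !tpermD // eq_sym ?i0e //; apply/negbT/rowN; rewrite ?(rx, ry, re, rl, ri0, rk0).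
  have s_l : s l = l by rewrite /s !tpermD //; apply/negbT/rowN; rewrite ?(rx, ry, re, rl, ri0, rk0).
  have s_x z : s z = i0 -> z = x.
    move=> sz; apply: (@perm_inj _ (tperm x i0)); apply: (@perm_inj _ (tperm y k0)).
    by rewrite -/(s z) sz tpermL tpermD //; apply/negbT/rowN; rewrite ?(rx, ry, re, rl, ri0, rk0).
  have s_y z : s z = k0 -> z = y.
    move=> sz; apply: (@perm_inj _ (tperm x i0)); apply: (@perm_inj _ (tperm y k0)).
    by rewrite -/(s z) sz (@tpermD _ x i0 y) ?tpermL //; apply/negbT/rowN; rewrite ?(rx, ry, re, rl, ri0, rk0).
  have nin : (x, e) \notin [set (y, l)].
    by rewrite inE xpair_eqE (negPf el) andbF.
  have -> : ('X_x - 'X_e) * ('X_y - 'X_l) = diff_prod K ((x, e) |: [set (y, l)]).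
    by rewrite /diff_prod big_setU1 // big_set1.
  apply: (@saturation_diff_prod _ _ _ hn hla hne T') => u v.
  rewrite inE /= !rT' !cT' => /andP[/eqP cuv ruv] /same_block[uv|[uF vF]|[uG vG]].
  - by rewrite uv ltnn in ruv.
  - rewrite !inE !xpair_eqE.
    have ve : v = e.
      by move: vF; rewrite inF => /orP[/eqP //|/eqP rv]; rewrite rv in ruv.
    have ru : row_of T u = 0%N.
      by move: uF; rewrite inF => /orP[/eqP ue|/eqP //]; rewrite ue ve ltnn in ruv.
    rewrite ve eqxx (s_x u) ?eqxx //; apply: (@box_inj _ _ T); last by rewrite cuv ve s_e ce ci0.
    by rewrite -[row_of T (s u)]/(row_of T' u) rT' ru ri0.
  rewrite !inE !xpair_eqE.
  have ru : row_of T u = 1%N.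
    move: uG; rewrite inG => /orP[/eqP ul|/eqP //]; rewrite ul rl in ruv.
    by move: vG; rewrite inG => /orP[/eqP vl|/eqP rv]; move: ruv; rewrite ?vl ?rl ?rv ?ltnn.
  have vl : v = l.
    by move: vG; rewrite inG => /orP[/eqP //|/eqP rv]; rewrite rv ru in ruv.
  rewrite vl eqxx (s_y u) ?eqxx ?orbT //; apply: (@box_inj _ _ T); last by rewrite cuv vl s_l cl ck0.
  by rewrite -[row_of T (s u)]/(row_of T' u) rT' ru rk0.
apply: (@quotient_not_cm _ I (collapse_prime K rp) (collapse_prime K rF)
  (collapse_prime K r1) (collapse_prime K rG)
  (fun f => f \in collapse_prime K rF) (fun f => f \in collapse_prime K rG)).
- exact: sub_F.
- exact: sub_G.
- apply: sub_collapse_prime => z; rewrite /rF; case: ifP => // zF.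
  by rewrite /r1 eF zF.
- apply: sub_collapse_prime => z; rewrite /r1; case: ifP => [zF|zF].
    by rewrite /rp eF zF.
  by case: ifP => // /eqP ->; rewrite /rp /rG (negPf lF) lG k1F k1G.
- apply: sub_collapse_prime => z; rewrite {1}/rG; case: ifP => // zG.
  rewrite /rp (negPf lF) /rG lG; case: ifP => [zF|_]; last by rewrite zG.
  by rewrite FG in zG.
- exists ('X_k1 - 'X_l); first by rewrite mem_collapse_primeX /r1 k1F eqxx (negPf lF) lk1.
  by rewrite mem_collapse_primeX /rF k1F (negPf lF) k1l.
- exists ('X_k2 - 'X_l); first by rewrite mem_collapse_primeX /rp /rG k2F (negPf lF) k2G lG.
  by rewrite mem_collapse_primeX /r1 k2F (negPf lF) k12 lk1 k2l.
- move=> x y xF yG; rewrite -/(saturation _ _ _).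
  apply: (saturation_collapse_ker _ xF) => u; rewrite mulrC.
  apply: (saturation_collapse_ker _ yG) => v; rewrite mulrC.
  rewrite /rF /rG; case: ifP => [|_]; last by rewrite subrr mul0r; apply: saturation0.
  rewrite inF => /orP[/eqP ->|/eqP ru]; first by rewrite subrr mul0r; apply: saturation0.
  case: ifP => [|_]; last by rewrite subrr mulr0; apply: saturation0.
  rewrite inG => /orP[/eqP ->|/eqP rv]; first by rewrite subrr mulr0; apply: saturation0.
  exact: sat_xy.
- exists ('X_i0 - 'X_e); rewrite mem_collapse_primeX /rF /rG.
    by rewrite i0F eF.
  by rewrite FG // (negPf eG) i0e.
- exists ('X_k2 - 'X_l); rewrite mem_collapse_primeX /rF /rG.
    by rewrite k2G lG.
  by rewrite k2F (negPf lF) k2l.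
move=> f; rewrite !mem_collapse_prime => /eqP fp.
exists 1%N, (f - collapse rF f), (collapse rF f); split; last by rewrite expr1 subrK.
  rewrite mem_collapse_prime rmorphB /= (@collapse_comp _ _ rF rF rF) ?subrr // => z.
  by rewrite {2}/rF; case: ifP => // zF; rewrite /rF eF zF.
by rewrite mem_collapse_prime (collapse_comp _ rp_rF) fp.
Qed.

End EqualRows.
(** * First two rows of different lengths *)

Section UnequalRows.
Variables (K : fieldType) (n : nat) (la : seq nat).
Hypotheses (hn : (2 <= n)%N) (hla : is_partition n la) (hne : la <> [:: n]).
Local Notation len i := (nth 0%N la i).
Local Notation I := (specht_ideal K hn hla hne).

(** Fix a tableau T.  The block S is its first row, S' its second row together
    with the entry e of the first box of the third row; B is their union.  Two
    elements of S, or two of S', always share a column by [same_column2], so the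
    Specht ideal vanishes on the subspace where S and S' are blocks.  Conversely,
    a tableau in which S or S' contains exactly one pair (x, y) of entries of a
    common column, all the other such pairs in B having one entry in each of S
    and S', shows that (X_x - X_y) z is in the Specht ideal locally.  When x, y
    are in S', put x on top of e in T.  When they are in S, the three entries of
    B in the first column must be two in S and one in S': an entry of S' has to
    move to the first row, namely to its last box, below which there is no other
    entry since the second row is shorter. *)
Lemma not_cm_unequal_rows :
  (len 1 < len 0)%N -> (2 <= len 1)%N -> (0 < len 2)%N ->
  ~ cohen_macaulay {ideal_quot I}.
Proof.
move=> len01 len1 len2.
have [T _] := tableau_exists hla.
have [e [re ce]] := box_filled T len2.
have [i0 [ri0 ci0]] := @box_filled _ _ T 0 0 (leq_ltn_trans (leq0n _) len01).
have last_col : ((len 0).-1 < len 0)%N by rewrite prednK // (leq_ltn_trans _ len01).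
have [y0 [ry0 cy0]] := box_filled T last_col.
have [k0 [rk0 ck0]] := @box_filled _ _ T 1 0 (ltnW len1).
have [k1 [rk1 ck1]] := box_filled T len1.
have cy0_gt0 : (0 < col_of T y0)%N.
  by rewrite cy0 -ltnS prednK ?(leq_trans len1 (ltnW len01)) // (leq_ltn_trans _ len01).
have len1y0 : (len 1 <= col_of T y0)%N.
  by rewrite cy0 -ltnS prednK // (leq_ltn_trans _ len01).
have rowN x y : row_of T x != row_of T y -> x == y = false.
  by move=> nxy; apply/negbTE/(row_neq (T := T)).
pose S := row_set T 0; pose S' := e |: row_set T 1; pose F := e |: row_set T 0.
have inS z : (z \in S) = (row_of T z == 0%N) by rewrite !inE.
have inS' z : (z \in S') = (z == e) || (row_of T z == 1%N) by rewrite !inE.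
have inF z : (z \in F) = (z == e) || (row_of T z == 0%N) by rewrite !inE.
(* The prime [q0] is that of [rF], [q1] that of [r1], [p] that of [rp], and [rG]
   gives the component with blocks S and S', represented by y0 and e. *)
pose inB z := (z \in S) || (z \in S').
pose rG z := if z \in S then y0 else if z \in S' then e else z.
pose rp z := if inB z then e else z.
pose rF z := if z \in F then e else z.
pose r1 z := if (z \in F) || (z == k0) then e else z.
have y0e : y0 == e = false by apply: rowN; rewrite ry0 re.
have i0y0 : i0 == y0 = false.
  by apply/eqP => iy; move: cy0_gt0; rewrite -iy ci0.
have k10 : k1 == k0 = false by apply/eqP => k10; move: ck1; rewrite k10 ck0.
have k0e : k0 == e = false by apply: rowN; rewrite rk0 re.
have k1e : k1 == e = false by apply: rowN; rewrite rk1 re.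
have eS : e \in S = false by rewrite inS re.
have eS' : e \in S' by rewrite inS' eqxx.
have eF : e \in F by rewrite inF eqxx.
have eB : inB e by rewrite /inB eS' orbT.
have y0S : y0 \in S by rewrite inS ry0.
have k0S : k0 \in S = false by rewrite inS rk0.
have k0S' : k0 \in S' by rewrite inS' rk0 orbT.
have k0F : k0 \in F = false by rewrite inF rk0 k0e.
have k1F : k1 \in F = false by rewrite inF rk1 k1e.
have SS' z : z \in S -> z \in S' = false.
  by rewrite inS inS' => /eqP rz; rewrite rz rowN // rz re.
have S'S z : z \in S' -> z \in S = false.
  by move=> zS'; apply/negbTE; apply: contraL zS' => /SS' ->.
have FB z : z \in F -> inB z.
  by rewrite inF /inB inS inS' => /orP[->|->]; rewrite ?orbT.
have rGG z : rG (rG z) = rG z.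
  rewrite /rG; case zS: (z \in S); first by rewrite y0S.
  by case zS': (z \in S'); [rewrite eS eS'|rewrite zS zS'].
pose t : {mpoly K[n]} := 'X_y0 - 'X_e.
have sub_F : {subset I <= collapse_prime K rF}.
  apply: specht_sub_collapse => T'.
  have [|x [y [xF yF nxy cxy]]] := @same_column _ _ hla T' F.
    by rewrite cardsU1 card_row_set inE re.
  by exists x, y; split=> //; rewrite /rF xF yF.
have sub_G : {subset I <= collapse_prime K rG}.
  apply: specht_sub_collapse => T'.
  have [|x [y [xy nxy cxy]]] := @same_column2 _ _ hla T' S S'.
    rewrite cardsU cardsU1 !card_row_set !inE re /=.
    rewrite (_ : S :&: S' = set0) ?cards0 ?subn0; first by rewrite add1n addnS.
    by apply/setP => z; rewrite in_setI in_set0; apply/negbTE/negP => /andP[/SS' ->].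
  exists x, y; split=> //; rewrite /rG; case/orP: xy => /andP[xS yS].
    by rewrite xS yS.
  by rewrite (S'S _ xS) (S'S _ yS) xS yS.
pose cross : {set 'I_n * 'I_n} :=
  [set c | (c.1 \in S) && (c.2 \in S') || (c.1 \in S') && (c.2 \in S)].
(* Both orders of each pair occur in [cross], so that the orientation of the
   factors of a Specht polynomial is irrelevant; z is only changed to its square,
   up to sign. *)
pose z := diff_prod K cross.
have z_rG : z \notin collapse_prime K rG.
  apply: diff_prod_notin => -[x y]; rewrite inE /= => /orP[]/andP[h h'].
    by rewrite /rG h h' (S'S _ h') y0e.
  by rewrite /rG h h' (S'S _ h) eq_sym y0e.
have same_block x y : rp x = rp y -> x = y \/ inB x /\ inB y.
  rewrite /rp; case xB: (inB x); case yB: (inB y) => exy; try by [right|left].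
    by rewrite -exy eB in yB.
  by rewrite exy eB in xB.
have inB_below u v : inB u -> inB v -> (row_of T u < row_of T v)%N ->
    v \in S' /\ (u \in S \/ row_of T u = 1%N /\ v = e).
  move=> uB vB ruv.
  have vS : v \in S = false by rewrite inS; apply/negbTE; rewrite -lt0n (leq_ltn_trans _ ruv).
  have vS' : v \in S' by move: vB; rewrite /inB vS.
  split=> //; case uS: (u \in S); [by left | right].
  have uS' : u \in S' by move: uB; rewrite /inB uS.
  have ue : u == e = false.
    apply/negbTE/negP => /eqP ue; move: vS' ruv; rewrite inS' ue re.
    by case/orP => /eqP ->; rewrite ?re.
  have ru : row_of T u = 1%N by move: uS'; rewrite inS' ue => /eqP.
  by split=> //; move: vS'; rewrite inS' => /orP[/eqP //|/eqP rv]; rewrite ru rv in ruv.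
have sat_z x : saturation I (collapse_prime K rp) (('X_x - 'X_(rG x)) * z).
  rewrite /rG; case xS: (x \in S); last case xS': (x \in S'); last first.
  - by rewrite subrr mul0r; apply: saturation0.
  - have [->|xe] := eqVneq x e; first by rewrite subrr mul0r; apply: saturation0.
    have rx : row_of T x = 1%N by move: xS'; rewrite inS' (negPf xe) => /eqP.
    have -> : ('X_x - 'X_e) * z = diff_prod K ((x, e) |: cross).
      by rewrite /diff_prod big_setU1 // inE /= xS eS andbF.
    pose T' := perm_tableau T (tperm x k0).
    have rT' u : row_of T' u = row_of T u by rewrite row_of_perm row_tperm // rx.
    apply: (@saturation_diff_prod _ _ _ hn hla hne T') => u v.
    rewrite inE !rT' /= => /andP[/eqP cuv ruv] /same_block[uv|[uB vB]].
      by rewrite uv ltnn in ruv.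
    rewrite in_setU1 inE xpair_eqE /=.
    have [vS' [uS|[ru ve]]] := inB_below u v uB vB ruv; first by rewrite uS vS' orbT.
    rewrite ve eqxx andbT; apply/orP; left; apply/eqP.
    apply: (@perm_inj _ (tperm x k0)); rewrite tpermL; apply: (@box_inj _ _ T).
      by rewrite -row_of_perm rT' ru rk0.
    by rewrite -col_of_perm cuv ve col_of_perm tpermD // ?ck0 ?ce // k0e.
  have [->|xy0] := eqVneq x y0; first by rewrite subrr mul0r; apply: saturation0.
  have rx : row_of T x = 0%N by move: xS; rewrite inS => /eqP.
  have -> : ('X_x - 'X_y0) * z = diff_prod K ((x, y0) |: cross).
    by rewrite /diff_prod big_setU1 // inE /= xS y0S !SS'.
  (* The first column starts with x, y0, e, while k0 takes the last box of the
     first row. *)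
  pose s u := tperm y0 k0 (tperm x i0 u).
  pose T' := perm_tableau (perm_tableau T (tperm y0 k0)) (tperm x i0).
  have xk0 : x == k0 = false by apply: rowN; rewrite rx rk0.
  have i0k0 : i0 == k0 = false by apply: rowN; rewrite ri0 rk0.
  have xe : x == e = false by apply: rowN; rewrite rx re.
  have i0e : i0 == e = false by apply: rowN; rewrite ri0 re.
  have s_e : s e = e by rewrite /s !tpermD // ?xe ?i0e ?y0e ?k0e.
  have s_y0 : s y0 = k0 by rewrite /s (@tpermD _ x) ?tpermL // i0y0.
  have s_x : s x = i0 by rewrite /s tpermL tpermD // eq_sym ?i0y0 // ?i0k0.
  have s_inj : injective s by move=> u v /perm_inj/perm_inj.
  have s_row u : s u != y0 -> s u != k0 -> row_of T (s u) = row_of T u.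
    rewrite /s -[row_of T u in RHS](@row_tperm _ _ T x i0) ?rx ?ri0 //.
    by case: tpermP => // _; rewrite eqxx.
  apply: (@saturation_diff_prod _ _ _ hn hla hne T') => u v.
  rewrite inE -[row_of T' u]/(row_of T (s u)) -[row_of T' v]/(row_of T (s v)).
  rewrite -[col_of T' u]/(col_of T (s u)) -[col_of T' v]/(col_of T (s v)) /=.
  move=> /andP[/eqP cuv ruv] /same_block[uv|[uB vB]].
    by rewrite uv ltnn in ruv.
  have v_y0 : s v != y0 by apply: contraTneq ruv => ->; rewrite ry0.
  have u_y0 : s u != y0.
    apply/eqP => uy; have := col_lt T (s v); rewrite -cuv uy ltnNge.
    rewrite (leq_trans _ len1y0) //; apply: (partition_nth_ge hla).
    exact: leq_ltn_trans ruv.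
  rewrite in_setU1 inE xpair_eqE /=.
  have [uk|u_k0] := eqVneq (s u) k0.
    have uy : u = y0 := s_inj _ _ (etrans uk (esym s_y0)).
    have v_k0 : s v != k0 by apply: contraTneq ruv => ->; rewrite uk ltnn.
    move: ruv; rewrite (s_row v) // uk rk0 => rv; apply/orP; right; rewrite uy y0S /=.
    by move: vB; rewrite /inB inS => /orP[/eqP r0|->] //; rewrite r0 in rv.
  have [vk|v_k0] := eqVneq (s v) k0.
    have -> : v = y0 := s_inj _ _ (etrans vk (esym s_y0)).
    rewrite eqxx (s_inj u x) ?eqxx // s_x; apply: (@box_inj _ _ T).
      by move: ruv; rewrite vk rk0 ri0; case: row_of.
    by rewrite cuv vk ck0 ci0.
  rewrite !s_row // in ruv.
  have [vS' [uS|[ru ve]]] := inB_below u v uB vB ruv; first by rewrite uS vS' orbT.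
  case/eqP: (u_k0); apply: (@box_inj _ _ T); first by rewrite s_row // ru rk0.
  by rewrite cuv ve s_e ce ck0.
apply: (@quotient_not_cm _ I (collapse_prime K rp) (collapse_prime K rF)
  (collapse_prime K r1) (collapse_prime K rG)
  (fun f => exists c, f = z * c) (fun f => f \in collapse_prime K rG)).
- exact: sub_F.
- exact: sub_G.
- apply: sub_collapse_prime => w; rewrite /rF; case: ifP => // wF.
  by rewrite /r1 eF wF.
- apply: sub_collapse_prime => w; rewrite /r1; case: ifP => // /orP[wF|/eqP ->].
    by rewrite /rp eB FB.
  by rewrite /rp eB /inB k0S' orbT.
- apply: sub_collapse_prime => w; rewrite /rG /rp.
  case wS: (w \in S); first by rewrite /inB y0S wS.
  by case wS': (w \in S'); rewrite ?eB /inB wS wS'.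
- exists ('X_k0 - 'X_e); first by rewrite mem_collapse_primeX /r1 k0F eF eqxx /=.
  by rewrite mem_collapse_primeX /rF k0F eF k0e.
- exists ('X_k1 - 'X_e); last by rewrite mem_collapse_primeX /r1 k1F eF k10 k1e.
  by rewrite mem_collapse_primeX /rp eB /inB inS' rk1 !orbT.
- move=> _ y [c ->] yG; rewrite -/(saturation _ _ _) mulrC.
  apply: (saturation_collapse_ker _ yG) => u; rewrite mulrA mulrC.
  exact: saturationM.
- by exists z => //; exists 1; rewrite mulr1.
- exists ('X_k0 - 'X_e); rewrite mem_collapse_primeX /rF /rG ?k0S ?k0S' ?eS ?eS' //.
  by rewrite k0F eF k0e.
(* Modulo the ideal of the component, f is a multiple of t and z is, up to sign, a
   power of t. *)
move=> f; rewrite mem_collapse_prime => /eqP fp.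
have [h def_h] : exists h, collapse rG f = t * h.
  pose r2 x := if x == y0 then e else x.
  have <- : collapse rG f - collapse r2 (collapse rG f) = collapse rG f.
    rewrite (@collapse_comp _ _ rG r2 rp) ?fp ?subr0 // => x.
    rewrite /r2 /rG /rp /inB; case xS: (x \in S); first by rewrite eqxx.
    case: (x \in S'); first by rewrite eq_sym y0e.
    by case: eqP => // xy; rewrite xy y0S in xS.
  apply: (@mem_sub_collapse _ _ (fun g => exists h, g = t * h)).
  - by exists 0; rewrite mulr0.
  - by move=> _ _ [a ->] [b ->]; exists (a + b); rewrite mulrDr.
  - by move=> c _ [a ->]; exists (c * a); rewrite mulrCA.
  move=> x; rewrite /r2; case: eqP => [->|_]; first by exists 1; rewrite mulr1.
  by exists 0; rewrite mulr0 subrr.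
have rG_t : collapse rG t = t.
  by rewrite rmorphB /= !collapseX /rG y0S eS eS'.
have [k [eps [eps2 rG_eps rG_z]]] : exists k eps, 
    [/\ eps * eps = 1, collapse rG eps = eps & collapse rG z = eps * t ^+ k].
  rewrite /z /diff_prod rmorph_prod /=.
  elim/big_rec: _ => [|[x y] g]; first by exists 0%N, 1; rewrite rmorph1 !mulr1.
  rewrite inE /= rmorphB /= !collapseX => xy [k [eps [eps2 rG_eps ->]]].
  case/orP: xy => /andP[h1 h2].
    exists k.+1, eps; split=> //.
    by rewrite /rG h1 h2 (S'S _ h2) -/t exprS mulrCA.
  exists k.+1, (- eps); split; rewrite ?mulrNN ?rmorphN /= ?rG_eps //.
  by rewrite /rG h1 h2 (S'S _ h1) -opprB -/t exprS mulNr mulrCA mulNr.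
have th_rG : t * collapse rG h = t * h.
  by rewrite -[RHS]def_h -(collapse_comp f rGG) def_h rmorphM /= rG_t.
exists k, (z * (eps * h ^+ k)), (f ^+ k - z * (eps * h ^+ k)); split.
- by exists (eps * h ^+ k).
- rewrite mem_collapse_prime rmorphB !rmorphM /= !rmorphXn /= rG_z rG_eps def_h.
  by rewrite mulrACA eps2 mul1r -exprMn th_rG subrr.
by rewrite addrC subrK.
Qed.

End UnequalRows.

(** * The classification *)

Local Close Scope ring_scope.
Local Close Scope quotient_scope.

Theorem proposition2p8 (K : fieldType) (n : nat) (la : seq nat)
    (hn : 2 <= n) (hla : is_partition n la) (hne : la <> [:: n]) :
  cohen_macaulay {ideal_quot (specht_ideal K hn hla hne)} ->
  [\/ nth 0 la 1 = 1,
      size la = 2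
    | [/\ size la = 3, nth 0 la 0 = nth 0 la 1 & nth 0 la 2 = 1]].
Proof.
move=> cm; have := partition_size_gt1 hla (ltnW hn) hne.
rewrite leq_eqVlt => /orP[/eqP sz2|sz]; first by constructor 2.
have nth_gt0 i : i < size la -> 0 < nth 0 la i.
  by case/and3P: (hla) => _ /all_nthP pos _; apply: pos.
have [/eqP|ne1] := boolP (nth 0 la 1 == 1); first by constructor 1.
have len1 : 1 < nth 0 la 1 by rewrite ltn_neqAle eq_sym ne1 nth_gt0 // ltnW.
have len2 := nth_gt0 2 sz.
have := partition_nth_ge hla (leqnSn 0); rewrite leq_eqVlt => /orP[/eqP len01|len01]; last first.
  by case: (not_cm_unequal_rows len01 len1 len2 cm).
(* As the second box below the two equal rows, take the first one of the fourth
   row or the second one of the third row. *)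
have [sz4|sz3] := ltnP 3 (size la).
  by case: (@not_cm_equal_rows _ _ _ hn hla hne 1 0 (esym len01) len1 len2 (nth_gt0 3 sz4) isT cm).
have [l2|l2] := ltnP 1 (nth 0 la 2).
  by case: (@not_cm_equal_rows _ _ _ hn hla hne 0 1 (esym len01) len1 len2 l2 isT cm).
constructor 3; split; first by apply/eqP; rewrite eqn_leq sz3.
  by [].
by apply/eqP; rewrite eqn_leq l2.
Qed.
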